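(* Let $n\ge 0$ and $0\le r\le n$, and let $\Gamma$ be any composite (in any order) of $r$ maps, each of which is $\Delta$ or $\Delta'$. Then the three multisets $$\{\!\{\Delta^r E\sigma:\sigma\in\mathfrak S_n\}\!\},\qquad \{\!\{\Delta'^r E\sigma:\sigma\in\mathfrak S_n\}\!\},\qquad \{\!\{\Gamma E\sigma:\sigma\in\mathfrak S_n\}\!\}$$ of vectors of $\mathbb N^{n-r}$ are equal.
   Context: For $n\ge 0$, $[n]=\{1,\dots,n\}$ and $\mathfrak S_n$ is the symmetric group on $[n]$. For $x\in\mathbb Z$, $x_+=\max\{0,x\}$. For $\sigma\in\mathfrak S_n$, $E\sigma=(E\sigma(1),\dots,E\sigma(n))\in\mathbb N^n$ where $E\sigma(k)=(\sigma(k)-(k-1))_+$. For $p\ge1$, the maps $\Delta,\Delta':\mathbb N^p\to\mathbb N^{p-1}$ are $\Delta(x_1,\dots,x_p)=((x_1-1)_+,\dots,(x_{p-1}-1)_+)$ and $\Delta'(x_1,\dots,x_p)=(x_2,\dots,x_p)$ (these two maps commute). A multiset $\{\!\{K\sigma:\sigma\in P\}\!\}$ records each value with multiplicity equal to the number of $\sigma\in P$ giving it. *)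

(* Defs.v *)
From mathcomp Require Import all_boot all_fingroup.
From mathcomp Require Import finmap multiset.

Set Implicit Arguments.
Unset Strict Implicit.
Unset Printing Implicit Defensive.

(* The value at the 0-based index i is (sigma(k) - (k - 1))_+ for k = i + 1,
   the 1-based value sigma(k) being (s i).+1; subtraction on nat is truncated. *)
Definition exc_vector (n : nat) (s : 'S_n) : n.-tuple nat :=
  [tuple (s i).+1 - i | i < n].

Definition vecmap : Type := forall p : nat, p.+1.-tuple nat -> p.-tuple nat.

Definition Delta : vecmap :=
  fun p x => [tuple tnth x (widen_ord (leqnSn p) i) - 1 | i < p].

Definition Delta' : vecmap :=
  fun p x => [tuple tnth x (lift ord0 i) | i < p].

(* compose g r n is g (r-1) \o ... \o g 1 \o g 0 (g 0 is applied first) on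
   vectors of length n >= r. When r > n, composition stops at length 0. *)
Fixpoint compose (g : nat -> vecmap) (r n : nat) {struct r} :
    n.-tuple nat -> (n - r).-tuple nat :=
  match r, n return n.-tuple nat -> (n - r).-tuple nat with
  | r'.+1, n'.+1 => fun x => compose (fun i => g i.+1) r' (g 0 n' x)
  | 0, n'.+1 => fun x => x
  | _, 0 => fun x => x
  end.

Definition perm_mset (n : nat) (T : choiceType) (K : 'S_n -> T) : {mset T}%mset :=
  seq_mset [seq K s | s : 'S_n].

(* Main.v *)
(** Coordinate [k] of [Gamma E sigma] is [(sigma(k+b) - (k+r-1))_+], where [b] is
    the number of factors of [Gamma] equal to [Delta']. Only the position [k+b] at
    which [sigma] is read depends on [b], so precomposing [sigma] with the [b]-th
    power of the cycle [(1 2 ... n)] reduces every [Gamma] to the case [b = 0]. *)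
Require Import Defs.
From mathcomp Require Import all_boot all_fingroup.
From mathcomp Require Import finmap multiset.

(** Truncated subtractions add up, so the order of the factors is irrelevant: [Delta] lowers values
    by one, [Delta'] shifts the index. The witness [b] precedes [n] and [x] because one shift must
    serve every permutation. *)
Lemma nth_compose (r : nat) (g : nat -> vecmap)
    (hg : forall i, i < r -> g i = Delta \/ g i = Delta') :
  exists2 b, b <= r & forall n (x : n.-tuple nat) i, i < n - r ->
    nth 0 (compose g r x) i = nth 0 x (i + b) - (r - b).
Proof.
elim: r g hg => [|r IHr] g hg.
  by exists 0 => // -[|n] x i // _; rewrite addn0 [RHS]subn0.
have [i i_lt_r|b le_br gE] := IHr (fun i => g i.+1); first exact: hg.
have [g0E|g0E] := hg 0 isT.
- exists b; first exact: leqW.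
  move=> [|n] x i // lt_i.
  (* The vector [g 0 n x] has length [n]; this bound keeps [nth] off its default value. *)
  have lt_ib : i + b < n
    by rewrite addnC -ltn_subRL (leq_trans lt_i) // subSS leq_sub2l.
  rewrite /= gE // g0E -[i + b]/(val (Ordinal lt_ib)) -tnth_nth tnth_mktuple.
  by rewrite (tnth_nth 0) /= -subnDA add1n subSn.
- exists b.+1 => // -[|n] x i // lt_i.
  have lt_ib : i + b < n
    by rewrite addnC -ltn_subRL (leq_trans lt_i) // subSS leq_sub2l.
  rewrite /= gE // g0E -[i + b]/(val (Ordinal lt_ib)) -tnth_nth tnth_mktuple.
  by rewrite (tnth_nth 0) lift0 /= addnS.
Qed.

(** [ordS] is the successor modulo [n]; the bound excludes wrapping around. *)
Lemma val_ordS_permX (n b : nat) (i : 'I_n) :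
  i + b < n -> val ((perm (@ordS_inj n) ^+ b)%g i) = i + b.
Proof.
rewrite permX; elim: b => [|b IHb] lt_ib; first by rewrite addn0.
rewrite iterS permE /= IHb; last by rewrite addnS in lt_ib; apply: ltnW.
by rewrite -addnS modn_small.
Qed.

(** Left translation permutes the group. In [c * s] the factor [c] acts first, so it moves the
    positions at which [s] is read. *)
Lemma perm_mset_mull (n : nat) (T : choiceType) (K : 'S_n -> T) (c : 'S_n) :
  perm_mset (fun s => K (c * s)%g) = perm_mset K.
Proof.
apply/eq_seq_msetP; rewrite [X in perm_eq X](map_comp K (mulg c)); apply: perm_map.
apply: uniq_perm => [||s]; rewrite ?(map_inj_uniq (mulgI c)) ?enum_uniq //.
rewrite mem_enum; apply/mapP; exists (c^-1 * s)%g; first by rewrite mem_enum.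
by rewrite mulKVg.
Qed.

(** The right-hand side is the case of [r] factors [Delta], a normal form free of [g]. *)
Lemma perm_mset_compose_exc (n r : nat) (g : nat -> vecmap)
    (hg : forall i, i < r -> g i = Delta \/ g i = Delta') :
  perm_mset (fun s : 'S_n => compose g r (exc_vector s)) =
  perm_mset (fun s : 'S_n =>
    [tuple (s (widen_ord (leq_subr r n) i)).+1 - (i + r) | i < n - r]).
Proof.
have [b le_br gE] := nth_compose r g hg.
rewrite -[RHS](perm_mset_mull _ _ _ (perm (@ordS_inj n) ^+ b)%g) /perm_mset.
congr seq_mset; apply: eq_map => s; apply: eq_from_tnth => i.
have lt_ib : i + b < n.
  by rewrite addnC -ltn_subRL (leq_trans (ltn_ord i)) ?leq_sub2l.
rewrite (tnth_nth 0) gE // -[i + b]/(val (Ordinal lt_ib)) -tnth_nth.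
(* The shift cancels in the amount subtracted: [(i + b) + (r - b) = i + r]. *)
rewrite !tnth_mktuple permM -subnDA -addnA subnKC //.
congr ((s _).+1 - _); apply: val_inj.
by rewrite val_ordS_permX.
Qed.

Theorem theorem1p5 (n r : nat) (hr : r <= n) (g : nat -> vecmap)
    (hg : forall i : nat, i < r -> g i = Delta \/ g i = Delta') :
  perm_mset (fun s : 'S_n => compose (fun=> Delta) r (exc_vector s)) =
    perm_mset (fun s : 'S_n => compose (fun=> Delta') r (exc_vector s)) /\
  perm_mset (fun s : 'S_n => compose (fun=> Delta') r (exc_vector s)) =
    perm_mset (fun s : 'S_n => compose g r (exc_vector s)).
Proof.
by split; rewrite !perm_mset_compose_exc //; move=> *; [right | left | right].
Qed.
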